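(* Let $G$ be a simple graph of order $n$ with chromatic number $\chi$ satisfying $3\le \chi\le n-1$, and let $\lambda_n$ be the least eigenvalue of the adjacency matrix of $G$. Then \[ \chi \le \left(\frac{n}{2}+1+\lambda_n\right) + \sqrt{\left(\frac{n}{2}+1+\lambda_n\right)^2 - 4(\lambda_n+1)\left(\lambda_n + \frac{n}{2}\right)}, \] with equality if and only if both $n$ and $\chi$ are even and $G \cong \left(K_{\chi/2}\cup\tfrac{n-\chi}{2}K_1\right) \vee \left(K_{\chi/2}\cup\tfrac{n-\chi}{2}K_1\right)$.
   Context: $K_k$ denotes the complete graph on $k$ vertices and $kK_1$ the edgeless graph on $k$ vertices. For vertex-disjoint graphs $H_1,H_2$, $H_1\cup H_2$ is their disjoint union, and $H_1\vee H_2$ is their join: the disjoint union together with all edges joining every vertex of $H_1$ to every vertex of $H_2$. *)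

(* Defs.v *)
From HB Require Import structures.
From mathcomp Require Import all_boot all_order all_algebra.
From mathcomp Require Import reals.

Set Implicit Arguments.
Unset Strict Implicit.
Unset Printing Implicit Defensive.

Import Order.TTheory GRing.Theory Num.Theory.

Record sgraph := SGraph {
  vertex :> finType;
  adj : rel vertex;
  adj_sym : symmetric adj;
  adj_irrefl : irreflexive adj
}.

Definition isomorphic (G H : sgraph) : Prop :=
  exists2 f : G -> H, bijective f & forall x y, adj (f x) (f y) = adj x y.

Section Constructions.

Definition complete_adj k : rel 'I_k := fun i j => i != j.

Lemma complete_sym k : symmetric (@complete_adj k).
Proof. by move=> i j; rewrite /complete_adj eq_sym. Qed.

Lemma complete_irrefl k : irreflexive (@complete_adj k).
Proof. by move=> i; rewrite /complete_adj eqxx. Qed.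

Definition complete_graph (k : nat) : sgraph :=
  SGraph (@complete_sym k) (@complete_irrefl k).

Definition edgeless_adj k : rel 'I_k := fun _ _ => false.

Lemma edgeless_sym k : symmetric (@edgeless_adj k).
Proof. by []. Qed.

Lemma edgeless_irrefl k : irreflexive (@edgeless_adj k).
Proof. by []. Qed.

Definition edgeless_graph (k : nat) : sgraph :=
  SGraph (@edgeless_sym k) (@edgeless_irrefl k).

Variables G H : sgraph.

Definition union_adj : rel (G + H)%type := fun u v =>
  match u, v with
  | inl x, inl y => adj x y
  | inr x, inr y => adj x y
  | _, _ => false
  end.

Lemma union_sym : symmetric union_adj.
Proof. by case=> x [] y //=; rewrite adj_sym. Qed.

Lemma union_irrefl : irreflexive union_adj.
Proof. by case=> x /=; rewrite adj_irrefl. Qed.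

Definition disjoint_union : sgraph := SGraph union_sym union_irrefl.

Definition join_adj : rel (G + H)%type := fun u v =>
  match u, v with
  | inl x, inl y => adj x y
  | inr x, inr y => adj x y
  | _, _ => true
  end.

Lemma join_sym : symmetric join_adj.
Proof. by case=> x [] y //=; rewrite adj_sym. Qed.

Lemma join_irrefl : irreflexive join_adj.
Proof. by case=> x /=; rewrite adj_irrefl. Qed.

Definition graph_join : sgraph := SGraph join_sym join_irrefl.

End Constructions.

Section Chromatic.

Variable G : sgraph.

Definition colorable (k : nat) : bool :=
  [exists c : {ffun G -> 'I_k}, forall x, forall y, adj x y ==> (c x != c y)].

Lemma colorable_ex : exists k, colorable k.
Proof.
exists #|G|; apply/existsP; exists [ffun x => enum_rank x].
apply/forallP => x; apply/forallP => y; apply/implyP => xy; rewrite !ffunE.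
by apply: contraTneq xy => /enum_rank_inj ->; rewrite adj_irrefl.
Qed.

Definition chromatic_number : nat := ex_minn colorable_ex.

End Chromatic.

Local Open Scope ring_scope.

Definition adjacency_mx (R : realType) (G : sgraph) : 'M[R]_#|G| :=
  \matrix_(i, j) (adj (enum_val i) (enum_val j))%:R.

Definition is_least_eigenvalue (R : realType) (m : nat) (A : 'M[R]_m) (l : R) : Prop :=
  eigenvalue A l /\ forall mu : R, eigenvalue A mu -> l <= mu.

(* Main.v *)
(** Put [t = - lambda_n], [a = chi / 2] and [b = (n - chi) / 2]; the bound is
    equivalent to [(t - 1) (t - b) <= a b], with the same equality case.  Since
    the adjacency matrix has trace 0, [t >= 0], and the claim is immediate for
    [t <= 1].  For [t > 1] take an eigenvector [x] and split the vertices into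
    [U = {x >= 0}] and its complement, with [P] and [Q] the sums of [|x|] over
    the two sides.  If [U] has degeneracy [d], some nonempty [S] in [U] has
    minimum degree at least [d]; summing the inequalities
    [t |x_v| + sum_(u in U adjacent to v) |x_u| <= Q] over [S], and bounding
    [|x_v| <= Q / t] on the rest of [U], gives
    [P <= ((d + 1) / (t + d) + (|U| - d - 1) / t) Q].  Multiply with the
    symmetric inequality for the complement, of degeneracy [e]: as degeneracy
    bounds greedy colouring, [chi <= (d + 1) + (e + 1)], and AM-GM together with
    convexity in [d], [e] yields the claim.  In the equality case both sides
    consist of a clique of order [chi / 2] and isolated vertices, and all the
    edges across are present. *)
Require Import Defs.
From HB Require Import structures.
From mathcomp Require Import all_boot all_order all_algebra.
From mathcomp Require Import reals complex.
From mathcomp Require Import lra ring zify.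

Set Implicit Arguments.
Unset Strict Implicit.
Unset Printing Implicit Defensive.

Import Order.TTheory GRing.Theory Num.Theory.
Local Open Scope ring_scope.

(** * Trace bound from the spectral theorem *)

(** Over the complex numbers a real symmetric matrix is Hermitian, hence unitarily diagonalizable
    with real spectrum. Each diagonal entry is an eigenvalue of [A], witnessed by a row of the
    unitary matrix, and the trace is their sum. *)
Lemma least_eigenvalue_mxtrace (R : rcfType) n (A : 'M[R]_n) (l : R) :
    A^T = A -> (forall mu, eigenvalue A mu -> l <= mu) -> l *+ n <= \tr A.
Proof.
move=> Asym lmin; pose AC := map_mx (real_complex R) A.
have ACreal : AC \is a mxOver Num.real.
  by apply/mxOverP => i j; rewrite mxE; apply/complex_realP; exists (A i j).
have ACherm : AC \is hermsymmx.
  apply: realsym_hermsym ACreal; apply/is_hermitianmxP.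
  by rewrite /= expr0 scale1r map_mx_id // map_trmx Asym.
have /mxOverP dreal := hermitian_spectral_diag_real ACherm.
have /hermitian_normalmx /orthomx_spectralP ACeq := ACherm.
have /fin_all_exists[r dE] j : exists k, spectral_diag AC 0 j = k%:C%C.
  by apply/complex_realP.
have leig j : l <= r j.
  apply: lmin; rewrite -(eigenvalue_map (real_complex R)) -/AC /=.
  rewrite -[X in eigenvalue _ X]dE.
  apply/eigenvalueP; exists (row j (spectralmx AC)).
    rewrite {2}ACeq !mulmxA -row_mul mulmxV ?spectral_unit//.
    by rewrite row1 -rowE row_diag_mx -scalemxAl -rowE.
  apply/eqP => row0; have /row_unitarymxP/(_ j j) := spectral_unitarymx AC.
  by rewrite row0 linear0l eqxx => /esym/eqP; rewrite oner_eq0.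
have -> : \tr A = \sum_j r j.
  apply: complexI; rewrite -trace_map_mx -/AC ACeq mxtrace_mulC mulmxA.
  rewrite mulmxV ?spectral_unit// mul1mx mxtrace_diag rmorph_sum /=.
  by apply: eq_bigr => j _; rewrite dE.
by rewrite -[n in l *+ n]card_ord -sumr_const ler_sum.
Qed.

(** * Degeneracy and greedy colouring *)

Section Degeneracy.
Variable G : sgraph.
Implicit Types S U : {set G}.

Definition deg_in S (v : G) : nat := #|[set u in S | adj v u]|.

(** For positive [k] this is the usual (k - 1)-degeneracy; the shift makes [k] the number of colours
    that suffice for greedy colouring. *)
Definition degenerate U k : bool :=
  [forall S : {set G}, (S \subset U) ==> (S != set0) ==>
    [exists v in S, deg_in S v < k]%N].

Definition proper_on U (c : G -> nat) (k : nat) : Prop :=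
  {in U, forall v, c v < k}%N /\
  {in U &, forall u v, adj u v -> c u != c v}.

(** Greedy induction: remove a vertex with fewer than [k] neighbours, colour the rest, and give it a
    colour that its neighbours miss. *)
Lemma degenerate_colorable U k :
  degenerate U k -> exists c, proper_on U c k.
Proof.
have [m] := ubnP #|U|; elim: m U => // m IHm U leUm degU.
have [->|U0] := eqVneq U set0.
  by exists (fun=> 0); split=> [v|u v]; rewrite in_set0.
have /existsP[v /andP[vU degv]] :
    [exists v in U, deg_in U v < k]%N.
  by move/forallP/(_ U): degU; rewrite subxx U0.
have [||c [ck cP]] := IHm (U :\ v).
- by rewrite [#|U|](cardsD1 v) vU in leUm.
- apply/forallP => S; apply/implyP => SU; move/forallP/(_ S): degU.
  by rewrite (subset_trans SU) ?subsetDl.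
have [/existsP[i /negP iP]|/existsPn full] :=
  boolP [exists i : 'I_k, (i : nat) \notin [seq c u | u in [set u in U | adj v u]]].
  have iN u : u \in U -> adj v u -> c u != i.
    move=> uU vu; apply/eqP => cui; apply: iP; rewrite -cui.
    by apply: image_f; rewrite inE uU.
  exists (fun u => if u == v then (i : nat) else c u); split=> [u uU|u w uU wU uw].
    by case: eqVneq => // uv; apply: ck; rewrite !inE uv.
  case: (eqVneq u v) (eqVneq w v) => [eu|nu] [ew|nw].
  - by move: uw; rewrite eu ew adj_irrefl.
  - by rewrite eq_sym iN // -eu.
  - by rewrite iN // -ew adj_sym.
  - by apply: cP; rewrite // !inE ?nu ?nw.
(* If all [k] colours occurred around [v], then [v] would have at least [k] neighbours in [U]. *)
have : (size (iota 0 k) <= size [seq c u | u in [set u in U | adj v u]])%N.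
  apply: uniq_leq_size (iota_uniq 0 k) _ => i; rewrite mem_iota /= add0n => ik.
  by have /negPn := full (Ordinal ik).
by rewrite size_iota size_image leqNgt degv.
Qed.

Lemma degenerate_card U : degenerate U #|G|.
Proof.
apply/forallP => S; apply/implyP => _; apply/implyP => /set0Pn[v vS].
apply/existsP; exists v; rewrite vS /=; apply: proper_card.
apply/properP; split; first by apply/subsetP.
by exists v; rewrite // inE adj_irrefl andbF.
Qed.

(** Colours on the complement are shifted by [k], so the two palettes are disjoint. *)
Lemma chromatic_number_le k l U c1 c2 :
  proper_on U c1 k -> proper_on (~: U) c2 l ->
  (chromatic_number G <= k + l)%N.
Proof.
move=> [c1k c1P] [c2l c2P]; rewrite /chromatic_number; case: ex_minnP => m _.
apply; pose c v := if v \in U then c1 v else (k + c2 v)%N.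
have ckl v : (c v < k + l)%N.
  rewrite /c; case: ifP => vU; first exact/ltn_addr/c1k.
  by rewrite ltn_add2l c2l // inE vU.
apply/existsP; exists [ffun v => Ordinal (ckl v)].
apply/forallP => u; apply/forallP => v; apply/implyP => uv.
rewrite !ffunE -val_eqE /= /c; case: ifP => uU; case: ifP => vU.
- exact: c1P.
- by rewrite ltn_eqF // ltn_addr ?c1k.
- by rewrite gtn_eqF // ltn_addr ?c1k.
- by rewrite eqn_add2l c2P // inE ?uU ?vU.
Qed.

(** Take the least [k] with [degenerate U k]; it is some [d.+1] because [U] is nonempty. Failure at
    [d] yields [S], and success at [d.+1] yields the colouring. *)
Lemma degeneracy_witness U : U != set0 -> exists d : nat, exists S : {set G},
  [/\ S \subset U, S != set0, {in S, forall v, d <= deg_in S v}%N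
    & exists c, proper_on U c d.+1].
Proof.
move=> U0.
have ex : exists k, degenerate U k by exists #|G|; apply: degenerate_card.
case: (ex_minnP ex) => -[|d] degU dmin.
  move/forallP/(_ U): degU; rewrite subxx U0 /= => /existsP[v].
  by rewrite ltn0 andbF.
have : ~~ degenerate U d by apply/negP => /dmin; rewrite ltnn.
case/forallPn => S; rewrite negb_imply => /andP[SU]; rewrite negb_imply => /andP[S0 SP].
move/exists_inPn: SP => SP.
exists d, S; split=> //; last exact: degenerate_colorable.
by move=> v vS; rewrite leqNgt SP.
Qed.

End Degeneracy.

(* In the extremal configuration the clique vertices have weight [Q / (t + d)]
   and the isolated ones [Q / t]; [side_ratio] is the resulting quotient [P / Q]. *)
Definition side_ratio (R : realFieldType) (t : R) (d p : nat) : R :=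
  d.+1%:R / (t + d%:R) + (p%:R - d.+1%:R) / t.

Lemma eq_in_sum_le (R : realFieldType) (I : finType) (A : {set I}) (f g : I -> R) :
  {in A, forall i, f i <= g i} -> \sum_(i in A) g i <= \sum_(i in A) f i ->
  {in A, f =1 g}.
Proof.
move=> fg gf i iA; apply/eqP; rewrite -subr_eq0 -oppr_eq0 opprB; apply/eqP.
have g0 j : j \in A -> 0 <= g j - f j by move=> jA; rewrite subr_ge0 fg.
apply: (psumr_eq0P g0) => //; apply/le_anti.
by rewrite sumr_ge0 // andbT sumrB subr_le0.
Qed.

(** * Weight bound on one side of the partition, and its equality case *)

Section OneSide.
Variables (R : realFieldType) (G : sgraph) (U S : {set G}) (y : G -> R).
Variables (t Q : R) (d : nat).
Hypothesis t_gt1 : 1 < t.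
Hypothesis y_ge0 : forall v, 0 <= y v.
Hypothesis yQ :
  {in U, forall v, t * y v + \sum_(u in U | adj v u) y u <= Q}.
Hypothesis SU : S \subset U.
Hypothesis S0 : S != set0.
Hypothesis degS : {in S, forall v, d <= deg_in S v}%N.

Let t_gt0 : 0 < t. Proof. exact: lt_trans t_gt1. Qed.
Let td_gt0 : 0 < t + d%:R. Proof. by rewrite ltr_wpDr. Qed.

Let neighborsS (v : G) : v \in S -> [set u in S | adj v u] \subset S :\ v.
Proof.
move=> vS; apply/subsetP => u; rewrite !inE => /andP[-> vu]; rewrite andbT.
by apply: contraTneq vu => ->; rewrite adj_irrefl.
Qed.

Lemma min_degree_lt_card : (d < #|S|)%N.
Proof.
case/set0Pn: S0 => v vS; rewrite (cardsD1 v) vS ltnS.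
exact: leq_trans (degS vS) (subset_leq_card (neighborsS vS)).
Qed.

Let cardS := min_degree_lt_card.

Let Q_ge0 : 0 <= Q.
Proof.
case/set0Pn: S0 => v vS; apply: le_trans (yQ (subsetP SU v vS)).
by rewrite addr_ge0 ?sumr_ge0 // mulr_ge0 // ltW.
Qed.

Let sum_neighbors_ge v :
  \sum_(u in S | adj v u) y u <= \sum_(u in U | adj v u) y u.
Proof.
rewrite big_mkcond [leRHS]big_mkcond ler_sum // => u _.
case: ifP => [/andP[uS ->]|_]; first by rewrite (subsetP SU).
by case: ifP.
Qed.

(** Double counting: the weight of each [u] in [S] occurs once per neighbour in [S], so at least [d]
    times. *)
Let sum_degS : d%:R * \sum_(v in S) y v <=
  \sum_(v in S) \sum_(u in S | adj v u) y u.
Proof.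
rewrite (exchange_big_dep (mem S)) /=; last by move=> ? ? ? /andP[].
rewrite mulr_sumr ler_sum // => u uS.
rewrite (eq_bigl (mem [set v in S | adj u v])); last first.
  by move=> v; rewrite !inE uS adj_sym.
by rewrite sumr_const -[leRHS]mulr_natl ler_wpM2r // ler_nat degS.
Qed.

Let sumS_le : (t + d%:R) * \sum_(v in S) y v <= #|S|%:R * Q.
Proof.
rewrite mulr_natl -sumr_const.
apply: (@le_trans _ _
  (\sum_(v in S) (t * y v + \sum_(u in S | adj v u) y u))).
  by rewrite big_split /= -mulr_sumr mulrDl lerD2l.
apply: ler_sum => v vS; apply: le_trans (yQ (subsetP SU v vS)).
by rewrite lerD2l.
Qed.

Let yD v : v \in U :\: S -> y v <= Q / t.
Proof.
rewrite inE => /andP[_ vU]; rewrite ler_pdivlMr // mulrC.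
by apply: le_trans (yQ vU); rewrite lerDl sumr_ge0.
Qed.

Let cardDU : #|U :\: S|%:R = #|U|%:R - #|S|%:R :> R.
Proof. by rewrite -(cardsID S U) (setIidPr SU) natrD; ring. Qed.

Let sumD_le : \sum_(v in U :\: S) y v <= (#|U|%:R - #|S|%:R) * Q / t.
Proof.
rewrite -cardDU -mulrA mulr_natl -sumr_const; exact: ler_sum.
Qed.

Let sumU : \sum_(v in U) y v =
  \sum_(v in S) y v + \sum_(v in U :\: S) y v.
Proof. by rewrite (big_setID S) (setIidPr SU). Qed.

Let sumS_le' : \sum_(v in S) y v <= #|S|%:R * Q / (t + d%:R).
Proof. by rewrite ler_pdivlMr // mulrC. Qed.

(** [S] may have more than [d.+1] vertices. Each extra one is estimated by Q / (t + d) instead of Q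
    / t, which saves Q d / (t (t + d)). *)
Let ratioE : side_ratio t d #|U| * Q =
  #|S|%:R * Q / (t + d%:R) + (#|U|%:R - #|S|%:R) * Q / t
  + (#|S|%:R - d.+1%:R) * (Q * d%:R / (t * (t + d%:R))).
Proof.
rewrite /side_ratio; field.
by rewrite !lt0r_neq0 //=.
Qed.

Lemma side_sum_le : \sum_(v in U) y v <= side_ratio t d #|U| * Q.
Proof.
rewrite ratioE sumU -[leLHS]addr0 lerD ?lerD //.
rewrite mulr_ge0 ?subr_ge0 ?ler_nat //.
by rewrite divr_ge0 ?mulr_ge0 // ltW.
Qed.

Hypothesis Q_gt0 : 0 < Q.
Hypothesis d_gt0 : (0 < d)%N.
Hypothesis tight : \sum_(v in U) y v = side_ratio t d #|U| * Q.

(** Equality makes the three nonnegative slacks vanish; the third has a positive coefficient as [d]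
    and [Q] are positive, which fixes the size of [S]. *)
Let slack :
  [/\ \sum_(v in S) y v = #|S|%:R * Q / (t + d%:R),
      \sum_(v in U :\: S) y v = (#|U|%:R - #|S|%:R) * Q / t &
      #|S| = d.+1].
Proof.
have e_gt0 : 0 < Q * d%:R / (t * (t + d%:R)).
  by rewrite divr_gt0 // mulr_gt0 // ltr0n.
have e_ge0 : 0 <= (#|S|%:R - d.+1%:R) * (Q * d%:R / (t * (t + d%:R))).
  by rewrite mulr_ge0 ?subr_ge0 ?ler_nat // ltW.
have splitting (s r A B E : R) : s <= A -> r <= B -> 0 <= E ->
  s + r = A + B + E -> [/\ s = A, r = B & E = 0] by move=> *; split; lra.
move: tight; rewrite sumU ratioE.
case/(splitting _ _ _ _ _ sumS_le' sumD_le e_ge0) => sE rE e0; split=> //.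
apply/eqP; move/eqP: e0; rewrite mulf_eq0 (gt_eqF e_gt0) orbF subr_eq0.
by rewrite eqr_nat.
Qed.

Lemma tight_card : #|S| = d.+1.
Proof. by case: slack. Qed.

(** A vertex of [S] has at least [d] neighbours among the [d] other vertices of [S]. *)
Lemma tight_clique : {in S &, forall u v, u != v -> adj u v}.
Proof.
move=> u v uS vS uv.
have : [set w in S | adj u w] == S :\ u.
  rewrite eqEcard neighborsS //=; apply: leq_trans (degS uS).
  by have := tight_card; rewrite (cardsD1 u) uS add1n => /succn_inj ->.
by move/eqP/setP/(_ v); rewrite !inE vS eq_sym uv /= => ->.
Qed.

Let tightD : {in U :\: S, forall v, y v = Q / t}.
Proof.
apply: (@eq_in_sum_le _ _ _ y (fun=> Q / t)); first exact: yD.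
by case: slack => _ -> _; rewrite sumr_const -[leLHS]mulr_natl cardDU mulrA.
Qed.

Let isolated_sum v : v \in U :\: S -> \sum_(u in U | adj v u) y u = 0.
Proof.
move=> vD; apply/le_anti; rewrite sumr_ge0 // andbT.
have vU : v \in U by case/setDP: vD.
by move: (yQ vU); rewrite (tightD vD) mulrCA divff ?gt_eqF // mulr1 gerDl.
Qed.

Let tightS : {in S, forall v, t * y v + \sum_(u in S | adj v u) y u = Q}.
Proof.
apply: (@eq_in_sum_le _ _ S _ (fun=> Q)) => [v vS|].
  by apply: le_trans (yQ (subsetP SU v vS)); rewrite lerD2l.
case: slack => sumSE _ _.
rewrite big_split /= -mulr_sumr sumr_const -[leLHS]mulr_natl.
have : #|S|%:R * Q = (t + d%:R) * \sum_(v in S) y v.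
  by rewrite sumSE mulrCA divff ?mulr1 // gt_eqF.
by move->; rewrite mulrDl lerD2l.
Qed.

(** Outside [S] the weight is Q / t. On the clique [S] the tight equation at [v] involves only [y v]
    and the known total over [S]; it gives y v = Q / (t + d). *)
Lemma tight_pos : {in U, forall v, 0 < y v}.
Proof.
move=> v vU; have [vS|vS] := boolP (v \in S); last first.
  by rewrite tightD ?divr_gt0 // inE vS.
have := tightS vS; rewrite (eq_bigl (fun u => (u \in S) && (u != v))).
  case: slack => sumSE _ cS eQ.
  have : \sum_(u in S) y u = y v + \sum_(u in S | u != v) y u.
    by rewrite (bigD1 v vS).
  rewrite sumSE cS => sE.
  have : (t - 1) * y v = Q * (t - 1) / (t + d%:R).
    have -> : (t - 1) * y v = Q - d.+1%:R * Q / (t + d%:R) by lra.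
    by rewrite -natr1; field; rewrite gt_eqF.
  move=> yE; rewrite -(pmulr_rgt0 _ (_ : 0 < t - 1)) ?subr_gt0 // yE.
  by rewrite divr_gt0 ?mulr_gt0 ?subr_gt0.
move=> u /=; case uS: (u \in S) => //=.
by case: eqVneq => [->|uv]; [rewrite adj_irrefl|rewrite tight_clique // eq_sym].
Qed.

(** The neighbours of [v] in [U] have total weight zero, although every weight in [U] is
    positive. *)
Lemma tight_isolated : {in U :\: S & U, forall v u, ~~ adj v u}.
Proof.
move=> v u vD uU; apply/negP => vu.
have y0 w : (w \in U) && adj v w -> 0 <= y w by [].
have yu0 : y u = 0 by apply: (psumr_eq0P y0 (isolated_sum vD)); rewrite uU.
by have := tight_pos uU; rewrite yu0 ltxx.
Qed.

Lemma tight_eq : {in U, forall v, t * y v + \sum_(u in U | adj v u) y u = Q}.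
Proof.
move=> v vU; have [vS|vS] := boolP (v \in S).
  by apply/le_anti; rewrite yQ // -{1}(tightS vS) lerD2l sum_neighbors_ge.
have vD : v \in U :\: S by rewrite inE vS.
by rewrite isolated_sum // tightD // mulrCA divff ?gt_eqF // mulr1 addr0.
Qed.

End OneSide.

(** * Combining the two sides by AM-GM and convexity *)

(** AM-GM bounds the sum of the ratios below by 2. Convexity of 1 / X bounds it above by its value
    at equal degeneracies, and the colouring constraint then allows replacing their average by a -
    1. *)
Lemma side_ratio_balance (R : realFieldType) (t : R) (d e p q : nat) (a b : R) :
    1 < t -> 1 < a -> p%:R + q%:R = 2 * (a + b) -> 2 * a <= d.+1%:R + e.+1%:R ->
    (d < p)%N -> (e < q)%N ->
    1 <= side_ratio t d p * side_ratio t e q ->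
  (t - 1) * (t - b) <= a * b /\
  ((t - 1) * (t - b) = a * b ->
    [/\ d = e, p = q, d.+1%:R = a & side_ratio t d p = 1]).
Proof.
move=> t1 a1 pq de dp eq F1.
set f := side_ratio t d p; set g := side_ratio t e q.
set X := t + d%:R; set Y := t + e%:R; set Z := t + a - 1.
have t0 : 0 < t by lra.
have X0 : 0 < X by rewrite /X ltr_wpDr.
have Y0 : 0 < Y by rewrite /Y ltr_wpDr.
have Z0 : 0 < Z by rewrite /Z; lra.
(* In this form the dependence on [d] passes through [X] alone, and t f is concave in [X]. *)
have fE : f = (p%:R - X + 2 * t - 1 - t * (t - 1) / X) / t.
  rewrite /f /side_ratio /X -natr1; field.
  by rewrite !gt_eqF.
have gE : g = (q%:R - Y + 2 * t - 1 - t * (t - 1) / Y) / t.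
  rewrite /g /side_ratio /Y -natr1; field.
  by rewrite !gt_eqF.
have f0 : 0 < f.
  rewrite /f /side_ratio ltr_wpDr ?divr_gt0 //.
  by rewrite divr_ge0 ?subr_ge0 ?ler_nat ?(ltW t0).
have g0 : 0 < g.
  rewrite /g /side_ratio ltr_wpDr ?divr_gt0 //.
  by rewrite divr_ge0 ?subr_ge0 ?ler_nat ?(ltW t0).
have fg2 : 2 <= f + g.
  have := sqr_ge0 (f - g); move: F1; rewrite -/f -/g => F1 sq.
  have : 2 ^+ 2 <= (f + g) ^+ 2 by nra.
  have fg_ge0 : 0 <= f + g by lra.
  by rewrite ler_pXn2r ?nnegrE.
have XYZ : 2 * Z <= X + Y.
  by move: de; rewrite /X /Y /Z -!natr1; lra.
(* [gap] measures [2 * a < d.+1 + e.+1], [conv] measures [d != e]; both are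
   nonnegative remainders in [main]. *)
pose gap := (X + Y - 2 * Z) * (1 - 2 * t * (t - 1) / (Z * (X + Y))).
have XY0 : 0 < X + Y by rewrite addr_gt0.
(* Since X + Y is at least 2 Z and Z exceeds t, the denominator Z (X + Y) is at least 2 Z^2, which
   exceeds 2 t (t - 1). *)
have coef0 : 0 < 1 - 2 * t * (t - 1) / (Z * (X + Y)).
  rewrite subr_gt0 ltr_pdivrMr ?mulr_gt0 // mul1r.
  apply: (@lt_le_trans _ _ (Z * (2 * Z))); last by rewrite ler_pM2l.
  have : 0 < a - 1 by lra.
  rewrite /Z; nra.
have gap0 : 0 <= gap by rewrite mulr_ge0 ?(ltW coef0) // subr_ge0.
pose conv := t * (t - 1) * (X - Y) ^+ 2 / (X * Y * (X + Y)).
have conv0 : 0 <= conv.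
  have den0 : 0 <= X * Y * (X + Y) by rewrite ltW // !mulr_gt0.
  by rewrite divr_ge0 // mulr_ge0 ?sqr_ge0 // mulr_ge0 ?subr_ge0 // ltW.
have sumE : t * (f + g) = 2 * (a + b) - 2 * Z + 4 * t - 2
    - 2 * t * (t - 1) / Z - gap - conv.
  rewrite -pq fE gE /gap /conv; field.
  by rewrite !gt_eqF.
have main : t * (f + g - 2) + gap + conv = 2 * (a * b - (t - 1) * (t - b)) / Z.
  have -> : t * (f + g - 2) = t * (f + g) - 2 * t by ring.
  rewrite sumE; rewrite /Z; field.
  by rewrite gt_eqF.
have fg0 : 0 <= t * (f + g - 2) by rewrite mulr_ge0 ?subr_ge0 // ltW.
split=> [|tight].
  have : 0 <= 2 * (a * b - (t - 1) * (t - b)) / Z by rewrite -main !addr_ge0.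
  by rewrite pmulr_lge0 ?invr_gt0 // pmulr_rge0 // subr_ge0.
(* Three nonnegative terms sum to zero: [conv] forces d = e, then [gap] forces d + 1 = a, and the
   first gives f + g = 2. With f g at least 1, this makes f = g = 1, whence p = q. *)
have main0 : t * (f + g - 2) + gap + conv = 0.
  by rewrite main tight subrr mulr0 mul0r.
have gap_eq : gap = 0 by lra.
have conv_eq : conv = 0 by lra.
have fg_eq : t * (f + g - 2) = 0 by lra.
have XY : X = Y.
  move/eqP: conv_eq; rewrite /conv !mulf_eq0 invr_eq0 !mulf_eq0.
  rewrite (gt_eqF t0) (gt_eqF X0) (gt_eqF Y0) (gt_eqF XY0) !orbF.
  by rewrite subr_eq0 (gt_eqF t1) /= orbb subr_eq0 => /eqP.
have de_eq : d = e.
  by apply/eqP; rewrite -(eqr_nat R); apply/eqP; move: XY; rewrite /X /Y; lra.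
have da : d.+1%:R = a.
  move/eqP: gap_eq; rewrite mulf_eq0 (gt_eqF coef0) orbF => /eqP.
  by rewrite /X /Y /Z -de_eq -natr1; lra.
have fg_2 : f + g = 2.
  by move/eqP: fg_eq; rewrite mulf_eq0 (gt_eqF t0) subr_eq0 => /eqP.
have fgeq : f = g.
  apply/eqP; rewrite -subr_eq0 -sqrf_eq0; apply/eqP/le_anti; rewrite sqr_ge0 andbT.
  by move: F1; rewrite -/f -/g; nra.
split=> //; last by rewrite -/f; lra.
apply/eqP; rewrite -(eqr_nat R); apply/eqP.
move: fgeq; rewrite fE gE XY => /(congr1 ( *%R^~ t)).
by rewrite !divfK ?gt_eqF //; lra.
Qed.

(** * Adjacency eigenvalues through functions on the vertices *)

Definition eigenfunction (R : realType) (G : sgraph) (l : R) (x : G -> R) : Prop :=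
  (forall v, \sum_(u | adj v u) x u = l * x v) /\ exists v, x v != 0.

Lemma eigenvalue_adjacencyP (R : realType) (G : sgraph) (l : R) :
  eigenvalue (adjacency_mx R G) l <-> exists x : G -> R, eigenfunction l x.
Proof.
have adjE (z : 'rV[R]_#|G|) v : (z *m adjacency_mx R G) 0 (enum_rank v) =
    \sum_(u | adj v u) z 0 (enum_rank u).
  rewrite mxE (reindex (@enum_rank G)) /=; last exact/onW_bij/enum_rank_bij.
  rewrite [RHS]big_mkcond; apply: eq_bigr => u _.
  by rewrite mxE !enum_rankK adj_sym; case: ifP => _; rewrite ?mulr1 ?mulr0.
split=> [/eigenvalueP[z zE z0]|[x [xE [v xv]]]].
  exists (fun v => z 0 (enum_rank v)); split=> [v|].
    by rewrite -adjE zE mxE.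
  by case/rV0Pn: z0 => i zi; exists (enum_val i); rewrite enum_valK.
apply/eigenvalueP; exists (\row_i x (enum_val i)).
  apply/rowP => i; rewrite -(enum_valK i) adjE !mxE enum_rankK -xE.
  by apply: eq_bigr => u _; rewrite mxE enum_rankK.
by apply/rV0Pn; exists (enum_rank v); rewrite mxE enum_rankK.
Qed.

(** There are no loops, so the trace is zero and the trace bound applies. *)
Lemma least_adjacency_eigenvalue_le0 (R : realType) (G : sgraph) (l : R) :
  (0 < #|G|)%N -> is_least_eigenvalue (adjacency_mx R G) l -> l <= 0.
Proof.
move=> G0 [_ lmin].
have Asym : (adjacency_mx R G)^T = adjacency_mx R G.
  by apply/matrixP => i j; rewrite !mxE adj_sym.
have := least_eigenvalue_mxtrace Asym lmin.
rewrite [leRHS]big1 => [|i _]; last by rewrite mxE adj_irrefl.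
by rewrite pmulrn_lle0.
Qed.

Lemma isomorphic_eigenvalue (R : realType) (G H : sgraph) (l : R) :
  isomorphic G H -> eigenvalue (adjacency_mx R H) l ->
  eigenvalue (adjacency_mx R G) l.
Proof.
move=> [f fbij fadj] /eigenvalue_adjacencyP[x [xE [v xv]]].
apply/eigenvalue_adjacencyP; exists (x \o f); split=> [u|].
  rewrite /= -xE [RHS](reindex f); last exact: onW_bij.
  by apply: eq_bigl => w; rewrite fadj.
by have [g _ gK] := fbij; exists (g v); rewrite /= gK.
Qed.

(** With weight [m] on clique vertices and t - 1 on isolated ones, the eigenvalue equation holds at
    clique vertices for every t; at isolated vertices it is exactly the assumed quadratic
    equation. *)
Lemma join_eigenvalue (R : realType) (k m : nat) (t : R)
    (H := disjoint_union (complete_graph k) (edgeless_graph m)) :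
    (0 < m)%N -> 1 < t -> (t - 1) * (t - m%:R) = k%:R * m%:R ->
  eigenvalue (adjacency_mx R (graph_join H H)) (- t).
Proof.
move=> m0 t1 tE; apply/eigenvalue_adjacencyP.
(* The eigenfunction has opposite signs on the two sides of the join. *)
pose h (z : H) : R := match z with inl _ => m%:R | inr _ => t - 1 end.
exists (fun z : graph_join H H => match z with inl z => h z | inr z => - h z end).
have sumh : \sum_(z : H) h z = k%:R * m%:R + m%:R * (t - 1).
  by rewrite big_sumType /= !sumr_const !card_ord !mulr_natl.
have sumadj (v : H) : \sum_(u : H | adj v u) h u = \sum_(u : H) h u - t * h v.
  rewrite sumh big_sumType /=; case: v => i /=.
    rewrite [X in _ + X]big_pred0 // addr0.
    have := @sumr_const R _ (mem 'I_k) m%:R; rewrite card_ord (bigD1 i) //= => sE.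
    rewrite (eq_bigl (fun j => j != i)) => [|j]; last by rewrite /complete_adj eq_sym.
    by rewrite mulr_natl -sE; ring.
  by rewrite !big_pred0 // addr0 -tE; ring.
split=> [[v|v]|]; last by exists (inl (inr (Ordinal m0))); rewrite /= gt_eqF ?subr_gt0.
  rewrite big_sumType /= sumrN.
  by have /= -> := sumadj v; ring.
rewrite big_sumType /= sumrN.
by have /= -> := sumadj v; ring.
Qed.

(** * The extremal structure and its isomorphism type *)

Record extremal_partition (G : sgraph) (U S T : {set G}) (k : nat) : Prop :=
  ExtremalPartition {
    extremal_half : #|U| = #|~: U|;
    extremal_subl : S \subset U;
    extremal_subr : T \subset ~: U;
    extremal_cardl : #|S| = k;
    extremal_cardr : #|T| = k;
    extremal_cliquel : {in S &, forall u v, u != v -> adj u v};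
    extremal_cliquer : {in T &, forall u v, u != v -> adj u v};
    extremal_isolatedl : {in U :\: S & U, forall v u, ~~ adj v u};
    extremal_isolatedr : {in ~: U :\: T & ~: U, forall v u, ~~ adj v u};
    extremal_cross : {in U & ~: U, forall v u, adj v u}
  }.

Lemma set_enumeration (T : finType) (A : {set T}) k : #|A| = k ->
  exists2 f : 'I_k -> T, injective f & forall i, f i \in A.
Proof.
by move=> <-; exists (@enum_val T (mem A)); [exact: enum_val_inj|exact: enum_valP].
Qed.

Lemma clique_isolated_embedding (G : sgraph) (U S : {set G}) k m :
    S \subset U -> #|S| = k -> #|U :\: S| = m ->
    {in S &, forall u v, u != v -> adj u v} ->
    {in U :\: S & U, forall v u, ~~ adj v u} ->
  exists h : disjoint_union (complete_graph k) (edgeless_graph m) -> G,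
    [/\ injective h, forall z, h z \in U & forall z w, adj (h z) (h w) = adj z w].
Proof.
move=> SU cS cD clique isol.
have [f finj fS] := set_enumeration cS; have [g ginj gD] := set_enumeration cD.
have gU j : g j \in U by case/setDP: (gD j).
have gS j : g j \notin S by case/setDP: (gD j).
exists (fun z => match z with inl i => f i | inr j => g j end); split.
- case=> i [] j => [/finj->|||/ginj->] // e.
    by move: (gS j); rewrite -e fS.
  by move: (gS i); rewrite e fS.
- by case=> i //; apply: (subsetP SU).
- case=> i [] j /=; rewrite /complete_adj.
  + case: eqVneq => [->|ij]; first by rewrite adj_irrefl.
    by apply: clique => //; rewrite (inj_eq finj).
  + by rewrite adj_sym; apply/negbTE/isol => //; apply: (subsetP SU).
  + by apply/negbTE/isol => //; apply: (subsetP SU).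
  + exact/negbTE/isol.
Qed.

Lemma extremal_isomorphic (G : sgraph) (U S T : {set G}) k
    (H := disjoint_union (complete_graph k) (edgeless_graph (#|U| - k))) :
  extremal_partition U S T k -> isomorphic G (graph_join H H).
Proof.
case=> cU SU TU cS cT cliqueS cliqueT isolS isolT cross.
have cDS : #|U :\: S| = (#|U| - k)%N by rewrite cardsD (setIidPr SU) cS.
have cDT : #|~: U :\: T| = (#|U| - k)%N by rewrite cardsD (setIidPr TU) cT cU.
have [f [finj fU fadj]] := clique_isolated_embedding SU cS cDS cliqueS isolS.
have [g [ginj gU gadj]] := clique_isolated_embedding TU cT cDT cliqueT isolT.
pose h (z : graph_join H H) := match z with inl z => f z | inr z => g z end.
have hinj : injective h.
  case=> z [] w /= => [/finj->|||/ginj->] // e.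
    by have := gU w; rewrite -e inE fU.
  by have := gU z; rewrite e inE fU.
(* This makes the truncated subtraction in [H] exact, so the orders agree and injectivity
   suffices. *)
have kU : (k <= #|U|)%N by rewrite -cS subset_leq_card.
have hbij : bijective h.
  apply: inj_card_bij hinj _.
  by rewrite !card_sum !card_ord -(cardsC U) -cU; lia.
have hadj z w : adj (h z) (h w) = adj z w.
  case: z w => z [] w /=; rewrite ?fadj ?gadj //; first exact: cross.
  by rewrite adj_sym; apply: cross.
have [h' hK h'K] := hbij; exists h'; first by exists h.
by move=> u v; rewrite -hadj !h'K.
Qed.

(** * The sign partition of an eigenfunction *)

Section LeastEigenfunction.
Variables (R : realType) (G : sgraph) (x : G -> R) (t : R).
Hypothesis t_gt1 : 1 < t.
Hypothesis x_eigen : eigenfunction (- t) x.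

Let U := [set v | 0 <= x v].
Let y v := `|x v|.
Let t_gt0 : 0 < t. Proof. exact: lt_trans t_gt1. Qed.

Let y_ge0 v : 0 <= y v. Proof. exact: normr_ge0. Qed.

Let yU v : v \in U -> y v = x v. Proof. by rewrite inE => /ger0_norm. Qed.

Let yCU v : v \in ~: U -> y v = - x v.
Proof. by rewrite !inE -ltNge => /ltr0_norm. Qed.

Let sum_split v : \sum_(u | adj v u) x u =
  \sum_(u in U | adj v u) y u - \sum_(u in ~: U | adj v u) y u.
Proof.
rewrite (bigID (mem U)) /= -sumrN; congr (_ + _).
  apply: eq_big => [u|u /andP[_ uU]]; first by rewrite andbC.
  by rewrite yU.
apply: eq_big => [u|u /andP[_ uU]]; first by rewrite in_setC andbC.
by rewrite yCU ?opprK // in_setC.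
Qed.

(** Separating signs in the eigenvalue equation puts same-side neighbours together with t y v,
    against the neighbours across. *)
Let balanceU v : v \in U ->
  t * y v + \sum_(u in U | adj v u) y u = \sum_(u in ~: U | adj v u) y u.
Proof.
by move=> vU; have [/(_ v)] := x_eigen; rewrite sum_split -(yU vU); lra.
Qed.

Let balanceCU v : v \in ~: U ->
  t * y v + \sum_(u in ~: U | adj v u) y u = \sum_(u in U | adj v u) y u.
Proof.
by move=> vU; have [/(_ v)] := x_eigen; rewrite sum_split; move: (yCU vU); nra.
Qed.

Let sum_adj_le (A : {set G}) v : \sum_(u in A | adj v u) y u <= \sum_(u in A) y u.
Proof.
by rewrite [leRHS](bigID (fun u => adj v u)) /= lerDl sumr_ge0.
Qed.

Let leU : {in U, forall v,
  t * y v + \sum_(u in U | adj v u) y u <= \sum_(u in ~: U) y u}.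
Proof. by move=> v vU; rewrite balanceU. Qed.

Let leCU : {in ~: U, forall v,
  t * y v + \sum_(u in ~: U | adj v u) y u <= \sum_(u in U) y u}.
Proof. by move=> v vU; rewrite balanceCU. Qed.

(** If the weight outside [A] were zero, the inequality would make [y] vanish on [A] too, and [x]
    would be zero. *)
Let other_side_pos (A : {set G}) :
  {in A, forall v, t * y v + \sum_(u in A | adj v u) y u <= \sum_(u in ~: A) y u} ->
  0 < \sum_(u in ~: A) y u.
Proof.
move=> leA; rewrite lt_neqAle sumr_ge0 // andbT; apply/eqP => /esym Q0.
have [_ [v]] := x_eigen; rewrite -normr_eq0 -/(y v) => /eqP; apply.
have [vA|vA] := boolP (v \in A); last first.
  by apply: (psumr_eq0P _ Q0) => //; rewrite inE.
have := leA v vA; rewrite Q0 => le0.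
have s0 : 0 <= \sum_(u in A | adj v u) y u by rewrite sumr_ge0.
have ty0 : t * y v <= 0 by lra.
by apply/le_anti; rewrite y_ge0 andbT -(pmulr_rle0 _ t_gt0).
Qed.

Let Q_gt0 : 0 < \sum_(u in ~: U) y u. Proof. exact: other_side_pos. Qed.

Let P_gt0 : 0 < \sum_(u in U) y u.
Proof. by rewrite -[U]setCK; apply: other_side_pos; rewrite setCK. Qed.

Let sum_adj_full (A : {set G}) v : {in A, forall u, 0 < y u} ->
  \sum_(u in A | adj v u) y u = \sum_(u in A) y u -> {in A, forall u, adj v u}.
Proof.
move=> ypos; rewrite [RHS](bigID (fun u => adj v u)) /= => sE u uA.
have s0 : \sum_(w in A | ~~ adj v w) y w = 0 by lra.
apply/negPn/negP => vu; have := ypos u uA.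
rewrite (_ : y u = 0) ?ltxx //.
by apply: (psumr_eq0P _ s0) => //; rewrite uA.
Qed.

Lemma least_eigenfunction_bound (a b : R) :
    1 < a -> 2 * a = (chromatic_number G)%:R -> 2 * (a + b) = #|G|%:R ->
  (t - 1) * (t - b) <= a * b /\
  ((t - 1) * (t - b) = a * b ->
    exists U S T k, [/\ @extremal_partition G U S T k & k%:R = a]).
Proof.
move=> a1 aE abE.
have nonempty (A : {set G}) : 0 < \sum_(u in A) y u -> A != set0.
  by move=> s0; apply: contraTneq s0 => ->; rewrite big_set0 ltxx.
have [d [S [SU S0 degS [c1 c1P]]]] := degeneracy_witness (nonempty _ P_gt0).
have [e [T [TU T0 degT [c2 c2P]]]] := degeneracy_witness (nonempty _ Q_gt0).
have P0 := P_gt0; have Q0 := Q_gt0.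
have PQ := side_sum_le t_gt1 y_ge0 leU SU S0 degS.
have QP := side_sum_le t_gt1 y_ge0 leCU TU T0 degT.
set P := \sum_(u in U) y u in P0 PQ QP *.
set Q := \sum_(u in ~: U) y u in Q0 PQ QP *.
have ratio_gt0 : 0 < side_ratio t d #|U|.
  by rewrite -(pmulr_lgt0 _ Q0) (lt_le_trans P0).
(* Chain the two side estimates, P <= f Q <= f g P, and cancel P > 0. *)
have ratio1 : 1 <= side_ratio t d #|U| * side_ratio t e #|~: U|.
  rewrite -(ler_pM2r P0) mul1r (le_trans PQ) // -mulrA.
  by rewrite ler_pM2l.
have dU := leq_trans (min_degree_lt_card S0 degS) (subset_leq_card SU).
have eU := leq_trans (min_degree_lt_card T0 degT) (subset_leq_card TU).
have cUE : #|U|%:R + #|~: U|%:R = 2 * (a + b) by rewrite abE -natrD cardsC.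
have kl : 2 * a <= d.+1%:R + e.+1%:R.
  by rewrite aE -natrD ler_nat (chromatic_number_le c1P c2P).
have [bnd tight] := side_ratio_balance t_gt1 a1 cUE kl dU eU ratio1.
split=> // /tight[de cU da ratioE]; subst e.
have d0 : (0 < d)%N by move: a1; rewrite -da -[1]/(1%:R) ltr_nat.
(* Both ratios are now 1, so P = Q and both side estimates are equalities. *)
rewrite -cU ratioE mul1r in QP; rewrite ratioE mul1r in PQ.
have PQE : P = Q by apply/le_anti; rewrite PQ.
have tU : P = side_ratio t d #|U| * Q by rewrite ratioE mul1r.
have tCU : Q = side_ratio t d #|~: U| * P by rewrite -cU ratioE mul1r.
exists U, S, T, d.+1; split=> //; split=> //.
- exact: (tight_card t_gt1 y_ge0 leU SU S0 degS Q0 d0 tU).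
- exact: (tight_card t_gt1 y_ge0 leCU TU T0 degT P0 d0 tCU).
- exact: (tight_clique t_gt1 y_ge0 leU SU S0 degS Q0 d0 tU).
- exact: (tight_clique t_gt1 y_ge0 leCU TU T0 degT P0 d0 tCU).
- exact: (tight_isolated t_gt1 y_ge0 leU SU S0 degS Q0 d0 tU).
- exact: (tight_isolated t_gt1 y_ge0 leCU TU T0 degT P0 d0 tCU).
(* By [tight_eq] and [balanceU] the neighbours of [v] across carry the full weight of that side; all
   weights there being positive, no vertex is missed. *)
- move=> v u vU; apply: sum_adj_full.
    exact: (tight_pos t_gt1 y_ge0 leCU TU T0 degT P0 d0 tCU).
  rewrite -balanceU //.
  exact: (tight_eq t_gt1 y_ge0 leU SU S0 degS Q0 d0 tU).
Qed.

End LeastEigenfunction.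

(** * From the quadratic inequality to the bound with the square root *)

(** The left side equals b - t (1 + b - t), which is at most b. *)
Lemma quadratic_lt_of_le1 (R : realFieldType) (a b t : R) :
  1 < a -> 0 < b -> 0 <= t <= 1 -> (t - 1) * (t - b) < a * b.
Proof.
move=> a1 b0 /andP[t0 t1].
have ab0 : b < a * b by rewrite ltr_pMl.
by nra.
Qed.

Lemma quadratic_bound (R : realType) (a b t : R) :
    1 < a -> 0 < b -> 0 <= t -> (t - 1) * (t - b) <= a * b ->
  let c := a + b + 1 - t in
  let bound := c + Num.sqrt (c ^+ 2 - 4 * (- t + 1) * (- t + (a + b))) in
  2 * a <= bound /\ (2 * a = bound <-> (t - 1) * (t - b) = a * b).
Proof.
move=> a1 b0 t0 tab c bound.
(* Completing the square shows that the root is at least |2 a - c| exactly when the quadratic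
   inequality holds. *)
have DE : c ^+ 2 - 4 * (- t + 1) * (- t + (a + b)) =
    (2 * a - c) ^+ 2 + 4 * (a * b - (t - 1) * (t - b)) by rewrite /c; ring.
rewrite /bound DE; set D := _ ^+ 2 + _.
have D2 : (2 * a - c) ^+ 2 <= D by rewrite /D lerDl; lra.
split.
  by have := ler_wsqrtr D2; rewrite sqrtr_sqr; have := ler_norm (2 * a - c); lra.
split=> [eqn|tight].
  have : D = (2 * a - c) ^+ 2.
    by rewrite eqn addrAC subrr add0r sqr_sqrtr // (le_trans _ D2) ?sqr_ge0.
  by rewrite /D; lra.
rewrite /D tight subrr mulr0 addr0 sqrtr_sqr ger0_norm; first by ring.
(* To drop the absolute value, 2 a - c = (a - 1) + (t - b) must be nonnegative; tightness forces t >
   1 and then t > b. *)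
have t1 : 1 < t.
  rewrite ltNge; apply/negP => t1.
  by have := quadratic_lt_of_le1 a1 b0 (t := t); rewrite tight ltxx t0 t1 => /(_ isT).
have tb : b < t.
  rewrite -subr_gt0 -(pmulr_rgt0 _ (_ : 0 < t - 1)) ?subr_gt0 // tight.
  by rewrite mulr_gt0 // (lt_trans _ a1).
by rewrite /c; lra.
Qed.

Theorem theorem3p2 (R : realType) (G : sgraph) (n chi : nat) (lambda_n : R)
    (order_G : #|G| = n)
    (chromatic_G : chromatic_number G = chi)
    (chi_bounds : (3 <= chi <= n - 1)%N)
    (least_lambda_n : is_least_eigenvalue (adjacency_mx R G) lambda_n) :
  let c : R := n%:R / 2 + 1 + lambda_n in
  let bound : R :=
    c + Num.sqrt (c ^+ 2 - 4 * (lambda_n + 1) * (lambda_n + n%:R / 2)) in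
  let H := disjoint_union (complete_graph chi./2)
                          (edgeless_graph (n - chi)./2) in
  chi%:R <= bound /\
  (chi%:R = bound <->
     ~~ odd n /\ ~~ odd chi /\ isomorphic G (graph_join H H)).
Proof.
pose a : R := chi%:R / 2; pose b : R := (n%:R - chi%:R) / 2; pose t := - lambda_n.
have a1 : 1 < a.
  have : 3%:R <= chi%:R :> R by rewrite ler_nat; case/andP: chi_bounds.
  by rewrite /a; lra.
have b0 : 0 < b.
  rewrite divr_gt0 // subr_gt0 ltr_nat; case/andP: chi_bounds; lia.
have t0 : 0 <= t.
  rewrite oppr_ge0; apply: (@least_adjacency_eigenvalue_le0 _ G) => //.
  by rewrite order_G; lia.
have aE : 2 * a = chi%:R by rewrite /a; lra.
have abE : 2 * (a + b) = n%:R by rewrite /a /b; lra.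
have [lambda_eig lambda_min] := least_lambda_n.
have [bnd tight] : (t - 1) * (t - b) <= a * b /\
    ((t - 1) * (t - b) = a * b ->
      exists U S T k, [/\ @extremal_partition G U S T k & k%:R = a]).
  have [t1|t1] := leP t 1.
    have lt_ab : (t - 1) * (t - b) < a * b by apply: quadratic_lt_of_le1; rewrite ?t0.
    by split=> [|e]; [exact: ltW|rewrite e ltxx in lt_ab].
  have /eigenvalue_adjacencyP[x xP] := lambda_eig.
  apply: (@least_eigenfunction_bound R G x) => //; rewrite ?chromatic_G ?order_G //.
  by rewrite opprK.
move=> c bound H.
have := quadratic_bound a1 b0 t0 bnd.
have -> : a + b = n%:R / 2 by lra.
rewrite /= !opprK aE -/c -/bound => -[le_bound eq_bound]; split=> //.
rewrite eq_bound; split=> [/tight[U [S [T [k [part ka]]]]]|[n_even [chi_even GH]]].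
  have chiE : chi = k.*2.
    by apply/eqP; rewrite -(eqr_nat R) -mul2n natrM ka aE.
  have nE : n = #|U|.*2.
    by rewrite -order_G -(cardsC U) -(extremal_half part) addnn.
  rewrite /H nE chiE !odd_double -doubleB !doubleK; do 2!split=> //.
  exact: extremal_isomorphic part.
have aN : a = (chi./2)%:R.
  have /(congr1 (fun m => m%:R : R)) := even_halfK chi_even.
  by rewrite -mul2n natrM /a; lra.
have bN : b = ((n - chi)./2)%:R.
  have nchi_even : ~~ odd (n - chi) by lia.
  have /(congr1 (fun m => m%:R : R)) := even_halfK nchi_even.
  by rewrite -mul2n natrM natrB /b; [lra|lia].
(* [- s] is the negative root of the quadratic in [lambda_n], and it is an
   eigenvalue of the join. *)
pose r := Num.sqrt ((b - 1) ^+ 2 + 4 * (a * b)); pose s := (b + 1 + r) / 2.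
have ab0 : 0 < a * b by rewrite mulr_gt0 // (lt_trans _ a1).
have r2 : r ^+ 2 = (b - 1) ^+ 2 + 4 * (a * b).
  by rewrite sqr_sqrtr // addr_ge0 ?sqr_ge0 //; lra.
have r0 : 0 <= r by exact: sqrtr_ge0.
have sE : (s - 1) * (s - b) = a * b by rewrite /s; lra.
have s1 : 1 < s.
  rewrite ltNge; apply/negP => s1; have := quadratic_lt_of_le1 a1 b0 (t := s).
  rewrite sE ltxx s1 andbT => /(_ _)/negP; apply; rewrite // /s; lra.
have : eigenvalue (adjacency_mx R G) (- s).
  apply: (isomorphic_eigenvalue GH); apply: join_eigenvalue; rewrite -?aN -?bN //.
  by rewrite -(ltr_nat R) -bN.
move=> /lambda_min; rewrite lerNr -/t => st.
apply/le_anti; rewrite bnd -sE /=.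
(* Both s and t lie to the right of the vertex (b + 1) / 2 of the parabola (t - 1) (t - b), which is
   increasing there. *)
have r_ge : b + 1 <= 2 * s by rewrite /s; lra.
by nra.
Qed.
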